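(* Let $\alpha,c,d,\tau>0$, $N\in\mathbb{N}$, $h=\frac1{N+1}$, and let $L_h$ be the $N\times N$ tridiagonal Dirichlet matrix with entries $(L_h)_{jj}=\frac{2d}{h^2}$, $(L_h)_{j,j\pm1}=-\frac{d}{h^2}$, and all other entries zero. Suppose $\tilde U_h^n,V_h^n\in\mathbb{R}^N$ satisfy, for $n\ge1$, the scheme in which the diffusion term is treated explicitly and the coupling term implicitly: $$\frac{\tilde U_h^n-\tilde U_h^{n-1}}{\tau}-\alpha(\sqrt c\,V_h^n-c\,\tilde U_h^n)+L_h\tilde U_h^{n-1}=0,\qquad \frac{V_h^n-V_h^{n-1}}{\tau}+\alpha(V_h^n-\sqrt c\,\tilde U_h^n)=0 .$$ If $\frac{2d\tau}{h^2}\le1$, then the scheme is strongly stable: for every $n\ge1$, $$\|\tilde U_h^n\|^2+\|V_h^n\|^2\le\|\tilde U_h^{n-1}\|^2+\|V_h^{n-1}\|^2 .$$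
   Context: $\|\cdot\|$ is the Euclidean norm on $\mathbb{R}^N$. The scheme is the symmetrized and rescaled form, with $\tilde U_h^n=\sqrt c\,U_h^n$ and zero source, of a finite difference discretization on $\Omega=(0,1)$ (with homogeneous Dirichlet conditions) of the system $u_t+v_t-d\,u_{xx}=0$, $v_t+\alpha(v-cu)=0$. *)

(* Defs.v *)
From mathcomp Require Import all_boot all_order all_algebra.
From mathcomp Require Import reals.

Set Implicit Arguments.
Unset Strict Implicit.
Unset Printing Implicit Defensive.

Import Order.TTheory GRing.Theory Num.Theory.
Local Open Scope ring_scope.

(* The norm that MathComp-Analysis puts on matrices is the sup norm. *)
Definition eucl_norm (R : realType) (N : nat) (x : 'cV[R]_N) : R :=
  Num.sqrt (\sum_(i < N) x i 0 ^+ 2).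

Definition dirichlet_mx (R : realType) (d h : R) (N : nat) : 'M[R]_N :=
  \matrix_(i < N, j < N)
    if i == j then 2 * d / h ^+ 2
    else if (i.+1 == j) || (j.+1 == i) then - (d / h ^+ 2)
    else 0.

(* Main.v *)
Require Import Defs.
From mathcomp Require Import all_boot all_order all_algebra.
From mathcomp Require Import reals.
From mathcomp Require Import ring lra.
Import Order.TTheory GRing.Theory Num.Theory.
Local Open Scope ring_scope.

(** One time step is the composition of two maps, each nonincreasing for the
    energy [sum_i (u_i^2 + v_i^2)].

    The explicit half-step replaces [u] by [w = (1 - tau L_h) u].  With
    [r = d tau / h^2] this matrix has diagonal entries [1 - 2 r] and
    entries [r] next to the diagonal, so the condition [2 r <= 1] makes it
    nonnegative; its row and column sums are then at most 1
    ([explicit_step_substochastic]), and such matrices contract the Euclidean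
    norm ([substochastic_sqr_sum_le]).

    The implicit half-step solves [(1 + tau K) (a, b) = (w, v)] separately at
    each grid point, where [K] is the coupling matrix with rows
    [alpha (c, - sqrt c)] and [alpha (- sqrt c, 1)].  As [K] is symmetric
    positive semidefinite, [1 + tau K] expands norms, hence its inverse
    contracts them ([coupling_step_expands]). *)

(** The Schur test with unit weights: writing [y = A x], the
    arithmetic-geometric inequality [2 x_j y_i <= x_j^2 + y_i^2], summed
    against [A i j], gives [2 |y|^2 <= |x|^2 + |y|^2]; the column sums control
    the first term and the row sums the second. *)
Lemma substochastic_sqr_sum_le {R : realFieldType} {m n : nat}
    (A : 'M[R]_(m, n)) (x : 'cV[R]_n) :
  (forall i j, 0 <= A i j) ->
  (forall i, \sum_j A i j <= 1) -> (forall j, \sum_i A i j <= 1) ->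
  \sum_i ((A *m x) i 0) ^+ 2 <= \sum_j x j 0 ^+ 2.
Proof.
move=> A_ge0 row_le1 col_le1; set y := A *m x.
have amgm : 2 * (\sum_i y i 0 ^+ 2)
    <= \sum_i \sum_j A i j * (x j 0 ^+ 2 + y i 0 ^+ 2).
  rewrite mulr_sumr; apply: ler_sum => i _.
  have -> : 2 * y i 0 ^+ 2 = \sum_j A i j * (2 * (x j 0 * y i 0)).
    rewrite expr2 {1}/y mxE mulr_suml mulr_sumr.
    by apply: eq_bigr => j _; ring.
  apply: ler_sum => j _; apply: ler_wpM2l => //.
  have := sqr_ge0 (x j 0 - y i 0); nra.
have split_sum : \sum_i \sum_j A i j * (x j 0 ^+ 2 + y i 0 ^+ 2)
    = \sum_j (\sum_i A i j) * x j 0 ^+ 2 + \sum_i (\sum_j A i j) * y i 0 ^+ 2.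
  under [X in _ = X + _]eq_bigr do rewrite mulr_suml.
  rewrite exchange_big /= [in RHS]exchange_big /= [X in X = _]exchange_big /=.
  rewrite -big_split; apply: eq_bigr => i _.
  rewrite mulr_suml -big_split; apply: eq_bigr => j _; exact: mulrDr.
have colx : \sum_j (\sum_i A i j) * x j 0 ^+ 2 <= \sum_j x j 0 ^+ 2.
  by apply: ler_sum => j _; rewrite ler_piMl ?sqr_ge0.
have rowy : \sum_i (\sum_j A i j) * y i 0 ^+ 2 <= \sum_i y i 0 ^+ 2.
  by apply: ler_sum => i _; rewrite ler_piMl ?sqr_ge0.
lra.
Qed.

Lemma sum_indicator_le1 {R : realFieldType} {n : nat} (P : pred 'I_n) :
  (forall i j, P i -> P j -> i = j) -> \sum_i (P i)%:R <= 1 :> R.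
Proof.
move=> P_inj; have [i0 Pi0|P0] := pickP P.
  rewrite (bigD1 i0) //= big1 ?Pi0 ?addr0 // => i ne.
  by case Pi: (P i) => //; rewrite (P_inj _ _ Pi Pi0) eqxx in ne.
by rewrite big1 ?ler01 // => i _; rewrite P0.
Qed.

Definition explicit_step_mx {R : realType} (d h tau : R) (N : nat) : 'M[R]_N :=
  1%:M - tau *: dirichlet_mx d h N.

(** A sum of three indicators instead of nested conditionals, so that a row
    sum splits into three counts. *)
Lemma explicit_step_mxE {R : realType} (d h tau : R) {N : nat} (i j : 'I_N) :
  explicit_step_mx d h tau N i j
    = (1 - 2 * d * tau / h ^+ 2) * (j == i)%:R
      + d * tau / h ^+ 2 * (j == i.+1 :> nat)%:R
      + d * tau / h ^+ 2 * (j.+1 == i :> nat)%:R.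
Proof.
rewrite !mxE [i.+1 == _]eq_sym [j == i]eq_sym.
have [->|ne] := eqVneq i j.
  by rewrite [_ == _.+1]ltn_eqF // gtn_eqF //=; ring.
case: eqP => [e1|_]; case: eqP => [e2|_] /=; try ring.
by move: e2; rewrite e1 => /eqP; rewrite gtn_eqF ?leqnSn.
Qed.

(** Each of the three diagonals meets a row at most once, so a row sum is at
    most [(1 - 2 r) + r + r = 1]; it loses an [r] at each end of the grid,
    where a neighbour is replaced by the zero boundary value. *)
Lemma explicit_step_substochastic {R : realType} (d h tau : R) (N : nat) :
  0 <= d -> 0 <= tau -> 2 * d * tau / h ^+ 2 <= 1 ->
  (forall i j, 0 <= explicit_step_mx d h tau N i j) /\
  (forall i, \sum_j explicit_step_mx d h tau N i j <= 1).
Proof.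
move=> d_ge0 tau_ge0 cfl.
have r_ge0 : 0 <= d * tau / h ^+ 2 by rewrite divr_ge0 ?sqr_ge0 ?mulr_ge0.
split=> [i j|i].
  rewrite explicit_step_mxE !addr_ge0 // mulr_ge0 ?ler0n //.
  by rewrite subr_ge0.
under eq_bigr do rewrite explicit_step_mxE.
rewrite !big_split /= -!mulr_sumr.
have diag : \sum_(j < N) (j == i)%:R <= 1 :> R.
  by apply: sum_indicator_le1 => j k /eqP-> /eqP->.
have upper : \sum_(j < N) (j == i.+1 :> nat)%:R <= 1 :> R.
  by apply: sum_indicator_le1 => j k /eqP ej /eqP ek; apply: val_inj; rewrite /= ej ek.
have lower : \sum_(j < N) (j.+1 == i :> nat)%:R <= 1 :> R.
  apply: sum_indicator_le1 => j k /eqP ej /eqP ek; apply: val_inj.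
  by apply: succn_inj; rewrite ej ek.
have diag_le : (1 - 2 * d * tau / h ^+ 2) * \sum_(j < N) (j == i)%:R
    <= 1 - 2 * d * tau / h ^+ 2 by rewrite ler_piMr ?subr_ge0.
have upper_le := ler_piMr r_ge0 upper; have lower_le := ler_piMr r_ge0 lower.
lra.
Qed.

Lemma explicit_step_contracts {R : realType} (d h tau : R) {N : nat}
    (u : 'cV[R]_N) :
  0 <= d -> 0 <= tau -> 2 * d * tau / h ^+ 2 <= 1 ->
  \sum_i ((explicit_step_mx d h tau N *m u) i 0) ^+ 2 <= \sum_i u i 0 ^+ 2.
Proof.
move=> d_ge0 tau_ge0 cfl.
have [A_ge0 row_le1] := explicit_step_substochastic d h tau N d_ge0 tau_ge0 cfl.
apply: substochastic_sqr_sum_le => // j.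
(* The matrix is symmetric, so its column sums are its row sums. *)
rewrite (eq_bigr (explicit_step_mx d h tau N j)) ?row_le1 // => i _.
by rewrite !explicit_step_mxE eq_sym [i == j.+1 :> nat]eq_sym
  [i.+1 == j :> nat]eq_sym addrAC.
Qed.

(** With [k = tau alpha] and [s = sqrt c], the matrix applied to [(a, b)] is
    [1 + k p p^T] for the vector [p = (s, -1)].  The cross term of the expanded
    square is [2 k (s a - b)^2] and the remainder is [|k (s a - b) p|^2]; both
    are nonnegative. *)
Lemma coupling_step_expands {R : realFieldType} (k s a b : R) : 0 <= k ->
  a ^+ 2 + b ^+ 2
    <= (a + k * (s ^+ 2 * a - s * b)) ^+ 2 + (b + k * (b - s * a)) ^+ 2.
Proof.
move=> k_ge0; rewrite -subr_ge0.
have -> : (a + k * (s ^+ 2 * a - s * b)) ^+ 2 + (b + k * (b - s * a)) ^+ 2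
    - (a ^+ 2 + b ^+ 2)
  = 2 * k * (s * a - b) ^+ 2 + k ^+ 2 * (s ^+ 2 + 1) * (s * a - b) ^+ 2 by ring.
apply: addr_ge0; apply: mulr_ge0; rewrite ?sqr_ge0 //.
  by apply: mulr_ge0; rewrite ?ler0n.
by apply: mulr_ge0; rewrite ?sqr_ge0 // addr_ge0 ?sqr_ge0 ?ler01.
Qed.

Lemma eucl_norm_sqr {R : realType} {N : nat} (x : 'cV[R]_N) :
  eucl_norm x ^+ 2 = \sum_i x i 0 ^+ 2.
Proof. by rewrite sqr_sqrtr ?sumr_ge0 // => i _; rewrite sqr_ge0. Qed.

Theorem corollary3 (R : realType) (alpha c d tau : R) (N : nat) (h : R)
    (U V : nat -> 'cV[R]_N)
    (alpha_gt0 : 0 < alpha) (c_gt0 : 0 < c) (d_gt0 : 0 < d) (tau_gt0 : 0 < tau)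
    (hE : h = 1 / N.+1%:R)
    (schemeU : forall n : nat, (1 <= n)%N ->
      tau^-1 *: (U n - U n.-1)
        - alpha *: (Num.sqrt c *: V n - c *: U n)
        + dirichlet_mx d h N *m U n.-1 = 0)
    (schemeV : forall n : nat, (1 <= n)%N ->
      tau^-1 *: (V n - V n.-1)
        + alpha *: (V n - Num.sqrt c *: U n) = 0)
    (cfl : 2 * d * tau / h ^+ 2 <= 1) :
  forall n : nat, (1 <= n)%N ->
    eucl_norm (U n) ^+ 2 + eucl_norm (V n) ^+ 2
      <= eucl_norm (U n.-1) ^+ 2 + eucl_norm (V n.-1) ^+ 2.
Proof.
move=> n n_ge1; rewrite !eucl_norm_sqr.
have tau_neq0 : tau != 0 by rewrite gt_eqF.
have sqrt_sqr : c = Num.sqrt c ^+ 2 by rewrite sqr_sqrtr // ltW.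
have contracts := explicit_step_contracts d h tau (U n.-1) (ltW d_gt0) (ltW tau_gt0) cfl.
apply: le_trans (lerD contracts (lexx _)).
rewrite -!big_split; apply: ler_sum => i _ /=.
have solveU : (explicit_step_mx d h tau N *m U n.-1) i 0
    = U n i 0 + tau * alpha
        * (Num.sqrt c ^+ 2 * U n i 0 - Num.sqrt c * V n i 0).
  have /matrixP /(_ i 0) := schemeU n n_ge1.
  rewrite /explicit_step_mx mulmxBl mul1mx -scalemxAl -sqrt_sqr.
  move: (dirichlet_mx d h N *m U n.-1) => Lu; rewrite !mxE => eqU.
  (* Adding [tau] times the scheme equation turns the claim into an identity. *)
  by rewrite -[LHS]addr0 -[X in _ + X](mulr0 tau) -eqU; field.
have solveV : V n.-1 i 0
    = V n i 0 + tau * alpha * (V n i 0 - Num.sqrt c * U n i 0).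
  have /matrixP /(_ i 0) := schemeV n n_ge1; rewrite !mxE => eqV.
  by rewrite -[LHS]addr0 -[X in _ + X](mulr0 tau) -eqV; field.
rewrite solveU solveV; apply: coupling_step_expands.
by rewrite mulr_ge0 ?ltW.
Qed.
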